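(* Let $\psi$ be a bounded complexity measure and $A$ a nonempty closed class of decision tables from $\mathcal{M}_k^2$. Then $G_{\psi,A}$ is a nondecreasing function, and: (a) if $S_\psi$ is bounded from above on $A$, then there is a constant $c\ge 0$ such that $G_{\psi,A}(n)\le c$ for all $n\in\omega$; (b) if $S_\psi$ is not bounded from above on $A$, then there is an infinite set $D\subseteq\omega$ such that $H_D(n)\le G_{\psi,A}(n)\le n$ for all $n\in\omega$.
   Context: Fix an integer $k\ge 2$; $\omega=\{0,1,2,\ldots\}$, $E_k=\{0,1,\ldots,k-1\}$, $E_2=\{0,1\}$. Let $P=\{f_i:i\in\omega\}$ be a set of attribute names ($f_i\ne f_j$ for $i\ne j$). $\mathcal{M}_k^2$ is the set of rectangular tables filled with numbers from $E_k$ whose columns are labeled with pairwise different attributes from $P$, whose rows are pairwise different, and in which each row is labeled with a decision from $E_2$. Tables without rows also belong to $\mathcal{M}_k^2$ and are all denoted $\Lambda$. Tables differing only by a permutation of rows are equal. $P(T)$ is the set of column attributes. $\mathcal{M}_k^2\mathcal{C}$ is the set of tables in which all rows have the same decision ($\Lambda$ included). $T(f_{i_1},\delta_1)\cdots(f_{i_m},\delta_m)$ is the table of rows of $T$ having values $\delta_1,\ldots,\delta_m$ in the columns labeled $f_{i_1},\ldots,f_{i_m}$. Operations: for $D\subseteq P(T)$, $I(D,T)$ deletes the columns labeled by $D$ and, in each group of rows coinciding on the remaining columns, keeps one row with the minimum decision; $I(P(T),T)=\Lambda$. For $\nu:E_k^{|P(T)|}\to E_2$, $J(\nu,T)$ replaces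 the decision of each row $\bar\delta$ by $\nu(\bar\delta)$. $[T]=\{J(\nu,I(D,T)):D\subseteq P(T),\nu:E_k^{|P(T)\setminus D|}\to E_2\}$; $[A]=\bigcup_{T\in A}[T]$; nonempty $A$ is a closed class if $[A]=A$. A $k$-decision tree: finite directed rooted tree with at least two nodes, root and its leaving edges unlabeled, terminal nodes labeled with decisions from $E_2$, other nodes labeled with attributes from $P$ whose leaving edges are labeled with numbers from $E_k$; $P(\Gamma)$ is the set of attributes at nodes. For a complete path $\tau=v_1,d_1,\ldots,v_m,d_m,v_{m+1}$ (root to terminal node), $F(\tau)$ is the empty word if $m=1$, else $f_{i_2}\cdots f_{i_m}$ where $v_j$ is labeled $f_{i_j}$; $T(\tau)=T$ if $m=1$, else $T(f_{i_2},\delta_2)\cdots(f_{i_m},\delta_m)$ with $d_j$ labeled $\delta_j$. For $T\notin\mathcal{M}_k^2\mathcal{C}$, a strongly nondeterministic decision tree for $T$: all terminal nodes labeled $1$, $P(\Gamma)\subseteq P(T)$, every row with decision $1$ lies in some $T(\tau)$, and for every complete path either $T(\tau)=\Lambda$ or all rows of $T(\tau)$ have decision $1$. Let $B$ be the set of finite words over $P$ (with empty word $\lambda$). A complexity measure is $\psi:B\to\omega$ with $\psi(\alpha)=0$ iff $\alpha=\lambda$, invariant under permutation of letters, $\psi(\alpha_1)\le\psi(\alpha_1\alpha_2)\le\psi(\alpha_1)+\psi(\alpha_2)$; bounded if $\psi(\alpha)\ge|\alpha|$. For finite $D\subseteq P$: $\psi(\emptyset)=0$, $\psi(\{f_{i_1},\ldots,f_{i_m}\})=\psi(f_{i_1}\cdots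 f_{i_m})$. $\psi(\Gamma)=\max_\tau\psi(F(\tau))$ over complete paths. Parameters ($0$ on $\Lambda$); for $T\ne\Lambda$: $\psi^s(T)=0$ if $T\in\mathcal{M}_k^2\mathcal{C}$ and otherwise the minimum of $\psi(\Gamma)$ over strongly nondeterministic decision trees for $T$; $W_\psi(T)=\psi(P(T))$; for a row $\bar\delta$, $S_\psi(T,\bar\delta)$ is the minimum of $\psi(D)$ over $D\subseteq P(T)$ such that on the columns labeled by $D$ the row $\bar\delta$ differs from all other rows of $T$, and $S_\psi(T)=\max_{\bar\delta}S_\psi(T,\bar\delta)$. $G_{\psi,A}(n)=\max\{\psi^s(T):T\in A,W_\psi(T)\le n\}$. For infinite $D=\{n_i:i\in\omega\}\subseteq\omega$ with $n_i<n_{i+1}$: $H_D(n)=0$ if $n<n_0$, $H_D(n)=n_i$ if $n_i\le n<n_{i+1}$. *)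

(* Defs.v *)
From HB Require Import structures.
From mathcomp Require Import all_boot finmap.
From mathcomp Require Import boolp classical_sets cardinality.

Set Implicit Arguments.
Unset Strict Implicit.
Unset Printing Implicit Defensive.

Local Open Scope fset_scope.
Local Open Scope fmap_scope.

(* The attribute f_i is encoded by its index i. *)
Notation attr := nat (only parsing).

Definition is_min (X : set nat) (m : nat) := X m /\ forall x, X x -> m <= x.
Definition is_max (X : set nat) (m : nat) := X m /\ forall x, X x -> x <= m.

(* Both are 0 when the extremum does not exist. *)
Definition min_of (X : set nat) : nat := xget 0 [set m | is_min X m].
Definition max_of (X : set nat) : nat := xget 0 [set m | is_max X m].

Section Tables.
Variable k : nat.

(* A row is a word over E_k; the decisions 0 and 1 are false and true. As a
   finite map from rows to decisions, a table has pairwise different rows and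
   does not depend on their order. *)
Definition rowmap := {fmap seq 'I_k -> bool}.

Definition rectangular (c : seq attr) (R : rowmap) : bool :=
  uniq c && [forall r : domf R, size (val r) == size c].

(* The last condition makes the table without rows unique, and identifies it
   with the table without columns, as required by I(P(T), T) = Λ. *)
Record table := Table {
  cols : seq attr;
  rows : rowmap;
  _ : rectangular cols rows && ((cols == [::]) == (domf rows == fset0))
}.

Definition table_pair (T : table) := (cols T, rows T).

Lemma table_pair_inj : injective table_pair.
Proof.
move=> [c R h] [c' R' h'] [/= ec eR]; case: _ / ec in h' *.
by case: _ / eR in h' *; rewrite (bool_irrelevance h h').
Qed.

Fact empty_table_wf :
  rectangular [::] ([fmap] : rowmap) &&
  (([::] == [::] :> seq attr) == (domf ([fmap] : rowmap) == fset0)).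
Proof.
apply/andP; split; last by rewrite eqxx.
apply/andP; split=> //; apply/forallP => -[r hr].
by exfalso; rewrite in_fset0 in hr.
Qed.

Definition empty_table : table := Table empty_table_wf.

Definition degenerate (c : seq attr) (R : rowmap) : bool :=
  (c == [::]) || (domf R == fset0).

Fact make_table_wf (c : seq attr) (R : rowmap) :
  rectangular c R -> degenerate c R = false ->
  rectangular c R && ((c == [::]) == (domf R == fset0)).
Proof. by move=> -> /norP[/negPf-> /negPf->]. Qed.

(* Sends every (c, R) without rows or without columns to Λ. *)
Definition make_table (c : seq attr) (R : rowmap) (h : rectangular c R) :
    table :=
  (if degenerate c R as b return degenerate c R = b -> table
   then fun _ => empty_table
   else fun e => Table (make_table_wf h e)) erefl.

Lemma rectangular_table (T : table) : rectangular (cols T) (rows T).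
Proof. by case: T => c R /= /andP[]. Qed.

(* P(T) *)
Definition attrs (T : table) : {fset attr} := [fset f in cols T].

Definition constant_table (T : table) : bool :=
  [forall r : domf (rows T), forall r' : domf (rows T),
     rows T r == rows T r'].

(* The value of row r in the column labeled f; None if there is no such
   column. *)
Definition entry (T : table) (r : seq 'I_k) (f : attr) : option 'I_k :=
  onth r (index f (cols T)).

(* T(f_1, δ_1)...(f_m, δ_m), for the word p = (f_1, δ_1) ... (f_m, δ_m) *)
Definition subrows (T : table) (p : seq (attr * 'I_k)) : rowmap :=
  filterf (rows T) (fun r => all (fun e => entry T r e.1 == Some e.2) p).

Fact subrows_rect T p : rectangular (cols T) (subrows T p).
Proof.
have /andP[u /forallP h] := rectangular_table T.
rewrite /rectangular u; apply/forallP => -[r hr] /=.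
have: r \in domf (rows T) by move: hr; rewrite mem_filterf => /andP[].
by move=> hr'; exact: (h [` hr']).
Qed.

Definition subtable T p : table := make_table (subrows_rect T p).

Definition del_word (D : {fset attr}) (T : table) (r : seq 'I_k) :=
  mask [seq f \notin D | f <- cols T] r.

Definition del_cols (D : {fset attr}) (T : table) : seq attr :=
  [seq f <- cols T | f \notin D].

(* The minimum of the decisions in a group of rows is their conjunction. *)
Definition del_rows (D : {fset attr}) (T : table) : rowmap :=
  [fmap s : [fset del_word D T r | r in domf (rows T)] =>
     [forall r : domf (rows T), (del_word D T (val r) == val s) ==> rows T r]].

Fact del_rect D T : rectangular (del_cols D T) (del_rows D T).
Proof.
have /andP[u /forallP h] := rectangular_table T.
rewrite /rectangular filter_uniq //=; apply/forallP => -[s hs] /=.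
have /imfsetP[r /= hr ->] := hs.
rewrite size_mask ?size_map; last by rewrite (eqP (h [` hr])).
by rewrite size_filter count_map.
Qed.

Definition opI (D : {fset attr}) (T : table) : table :=
  make_table (del_rect D T).

Definition relabel (nu : seq 'I_k -> bool) (T : table) : rowmap :=
  [fmap r : domf (rows T) => nu (val r)].

Fact relabel_rect nu T : rectangular (cols T) (relabel nu T).
Proof. exact: rectangular_table. Qed.

(* Only the values of ν on the words of length |P(T)| matter. *)
Definition opJ (nu : seq 'I_k -> bool) (T : table) : table :=
  make_table (relabel_rect nu T).

Definition closure1 (T : table) : set table :=
  [set T' | exists (D : {fset attr}) nu, (D `<=` attrs T)%fset /\ T' = opJ nu (opI D T)].

Definition table_closure (A : set table) : set table :=
  (\bigcup_(T in A) closure1 T)%classic.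

Definition closed_class (A : set table) : Prop :=
  (A !=set0)%classic /\ table_closure A = A.

(* Non-root nodes. A node labeled with an attribute has at least one leaving
   edge, here the first one and the list of the others. *)
Inductive node :=
  | Terminal of bool
  | Inner of attr & 'I_k * node & seq ('I_k * node).

(* The root, given by its nonempty list of children. *)
Inductive dtree := Root of node & seq node.

Definition children (G : dtree) : seq node := let: Root v vs := G in v :: vs.

Fixpoint node_terminals (v : node) : seq bool :=
  match v with
  | Terminal d => [:: d]
  | Inner _ e es =>
      node_terminals e.2 ++ flatten [seq node_terminals e'.2 | e' <- es]
  end.

Definition terminals (G : dtree) : seq bool :=
  flatten [seq node_terminals v | v <- children G].

Fixpoint node_attrs (v : node) : seq attr :=
  match v with
  | Terminal _ => [::]
  | Inner f e es =>
      f :: node_attrs e.2 ++ flatten [seq node_attrs e'.2 | e' <- es]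
  end.

(* P(Γ), as a list *)
Definition tree_attrs (G : dtree) : seq attr :=
  flatten [seq node_attrs v | v <- children G].

(* A complete path v_1, d_1, ..., v_m, d_m, v_(m+1) is recorded as the word
   (f_2, δ_2) ... (f_m, δ_m), where f_j labels v_j and δ_j labels d_j. *)
Fixpoint node_paths (v : node) : seq (seq (attr * 'I_k)) :=
  match v with
  | Terminal _ => [:: [::]]
  | Inner f e es =>
      [seq (f, e.1) :: p | p <- node_paths e.2] ++
      flatten [seq [seq (f, e'.1) :: p | p <- node_paths e'.2] | e' <- es]
  end.

Definition complete_paths (G : dtree) : seq (seq (attr * 'I_k)) :=
  flatten [seq node_paths v | v <- children G].

Definition path_word (p : seq (attr * 'I_k)) : seq attr := [seq e.1 | e <- p].

Definition strongly_nondet (T : table) (G : dtree) : Prop :=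
  [/\ all id (terminals G),
      {subset tree_attrs G <= attrs T},
      forall r, (rows T).[? r] = Some true ->
        exists2 p, p \in complete_paths G & r \in domf (rows (subtable T p)) &
      forall p, p \in complete_paths G ->
        subtable T p = empty_table \/
        (forall r : domf (rows (subtable T p)), rows (subtable T p) r = true)].

Section Measure.
Variable psi : seq attr -> nat.

Definition complexity_measure : Prop :=
  [/\ forall a, psi a = 0 <-> a = [::],
      forall a b, perm_eq a b -> psi a = psi b &
      forall a b, psi a <= psi (a ++ b) <= psi a + psi b].

Definition bounded_measure : Prop :=
  complexity_measure /\ forall a, size a <= psi a.

Definition psi_set (D : {fset attr}) : nat := psi (enum_fset D).

Definition psi_tree (G : dtree) : nat :=
  \max_(p <- complete_paths G) psi (path_word p).

Definition psi_s (T : table) : nat :=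
  if constant_table T then 0
  else min_of [set psi_tree G | G in [set G | strongly_nondet T G]]%classic.

Definition W_psi (T : table) : nat := psi_set (attrs T).

Definition separates (T : table) (r : seq 'I_k) (D : {fset attr}) : Prop :=
  D `<=` attrs T /\
  forall r', r' \in domf (rows T) -> r' != r ->
    exists2 f, f \in D & entry T r f != entry T r' f.

Definition S_row (T : table) (r : seq 'I_k) : nat :=
  min_of [set psi_set D | D in separates T r]%classic.

Definition S_psi (T : table) : nat := \max_(r <- domf (rows T)) S_row T r.

Definition G_values (A : set table) (n : nat) : set nat :=
  [set psi_s T | T in [set T | A T /\ W_psi T <= n]]%classic.

Definition G_fun (A : set table) (n : nat) : nat := max_of (G_values A n).

End Measure.
End Tables.

Definition increasing_enum (D : set nat) (d : nat -> nat) : Prop :=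
  (forall i, d i < d i.+1) /\ D = range d.

(* H_D, for D enumerated increasingly by d *)
Definition H_fun (d : nat -> nat) (n : nat) : nat :=
  if n < d 0 then 0 else d (xget 0 [set i | d i <= n < d i.+1]).

(* Main.v *)
(** For a row r, querying the columns of a separating set D isolates r, so the
    tree with one such path per row with decision 1 gives
    psi^s(T) <= S_psi(T), and likewise psi^s(T) <= W_psi(T) with D = P(T).
    Conversely, take for a row r a separating set D of measure S_psi(T, r) that
    is minimal by inclusion, delete the columns outside D, and give decision 1
    to the image of r only. By minimality, every column f of D has a row
    differing from r exactly at f, so a path of a strongly nondeterministic
    tree that accepts r must query all of D: in the new table
    psi^s = W_psi = S_psi(T, r). Hence if S_psi is unbounded on A, then
    G(n) = n for infinitely many n, and monotonicity of G does the rest. *)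

Require Import Defs.
From mathcomp Require Import all_boot finmap.
From mathcomp Require Import boolp classical_sets cardinality.

Set Implicit Arguments.
Unset Strict Implicit.
Unset Printing Implicit Defensive.

Local Open Scope fset_scope.
Local Open Scope fmap_scope.

(** * Extrema of sets of naturals and entries of masked words *)

Lemma min_ofP (X : set nat) x : X x -> is_min X (min_of X).
Proof.
move=> Xx; apply: xgetPex.
have ex : exists n, `[< X n >] by exists x; apply/asboolP.
case: (ex_minnP ex) => m /asboolP Xm mP; exists m; split=> // y Xy.
by apply: mP; apply/asboolP.
Qed.

Lemma max_ofP (X : set nat) x b :
  X x -> (forall y, X y -> y <= b) -> is_max X (max_of X).
Proof.
move=> Xx Xb; apply: xgetPex.
have ex : exists n, `[< X n >] by exists x; apply/asboolP.
have ub n : `[< X n >] -> n <= b by move=> /asboolP /Xb.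
case: (ex_maxnP ex ub) => m /asboolP Xm mP; exists m; split=> // y Xy.
by apply: mP; apply/asboolP.
Qed.

Lemma onth_index_mask (S : eqType) (U : Type) (a : pred S) (c : seq S)
    (r : seq U) (f : S) :
  size r = size c -> a f ->
  onth (mask [seq a g | g <- c] r) (index f [seq g <- c | a g])
  = onth r (index f c).
Proof.
move=> + af; elim: c r => [|g c IH] [|x r] //= [sz].
case: (altP (g =P f)) => [->|gf]; first by rewrite af /= eqxx.
by case: (a g); rewrite /= ?(negPf gf) /= IH.
Qed.

(** * Rows of tables and subtables *)

Section Tables.
Variable k : nat.
Implicit Types (T : table k) (r : seq 'I_k).

Lemma size_row T r : r \in domf (rows T) -> size r = size (cols T).
Proof.
by have /andP[_ /forallP h] := rectangular_table T => hr; apply/eqP/(h [` hr]).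
Qed.

(** With [c] nonempty, the collapse to Λ happens only if [R] is already empty. *)
Lemma rows_make_table (c : seq nat) (R : rowmap k) (h : rectangular c R) :
  c != [::] -> rows (make_table h) = R.
Proof.
move=> c0; rewrite /make_table.
(* Generalizing the equality proof consumed by the dependent [if] makes the case analysis well
   typed. *)
move: (erefl (degenerate c R)); case: {2 3}(degenerate c R) => // e.
move: e; rewrite /degenerate (negPf c0) /= => /eqP R0.
by rewrite (fmap_nil R0).
Qed.

Lemma cols_make_table (c : seq nat) (R : rowmap k) (h : rectangular c R) :
  cols (make_table h) = if degenerate c R then [::] else c.
Proof.
rewrite /make_table; move: (erefl (degenerate c R)).
by case: {2 3}(degenerate c R) => e; rewrite e.
Qed.

Lemma cols_nil T : (cols T == [::]) = (domf (rows T) == fset0).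
Proof. by case: T => c R /= /andP[_ /eqP]. Qed.

(** A table without columns has no rows either, so here the collapse to Λ never loses a row. *)
Lemma rows_subtable T p : rows (subtable T p) = subrows T p.
Proof.
have [c0|] := eqVneq (cols T) [::]; last exact: rows_make_table.
have R0 : domf (subrows T p) = fset0.
  apply/eqP; rewrite -fsubset0; apply/fsubsetP => r; rewrite mem_filterf.
  have /eqP T0 : domf (rows T) == fset0 by rewrite -cols_nil c0.
  by move=> /andP[hr _]; have : r \in domf (rows T) := hr; rewrite T0.
rewrite /subtable /make_table.
move: (erefl (degenerate (cols T) (subrows T p))).
case: {2 3}(degenerate _ _) => //= _.
by rewrite (fmap_nil R0).
Qed.

Lemma mem_subtable T p r :
  (r \in domf (rows (subtable T p)))
  = (r \in domf (rows T)) && all (fun e => entry T r e.1 == Some e.2) p.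
Proof. by rewrite rows_subtable mem_filterf. Qed.

Lemma fnd_subtable T p r :
  r \in domf (rows (subtable T p)) ->
  (rows (subtable T p)).[? r] = (rows T).[? r].
Proof.
by rewrite rows_subtable mem_filterf => /andP[_ h]; rewrite fnd_filterf h.
Qed.

(** Works row by row on entries instead of subtables. On Λ the condition on rows is vacuous, so the
    two cases for a path merge. *)
Lemma strongly_nondetP T (G : dtree k) :
  strongly_nondet T G <->
  [/\ all id (terminals G),
      {subset tree_attrs G <= cols T},
      forall r, (rows T).[? r] = Some true ->
        exists2 p, p \in complete_paths G &
          all (fun e => entry T r e.1 == Some e.2) p &
      forall p r, p \in complete_paths G -> r \in domf (rows T) ->
        all (fun e => entry T r e.1 == Some e.2) p ->
        (rows T).[? r] = Some true].
Proof.
split=> -[h1 h2 h3 h4]; split=> //.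
- by move=> f /h2; rewrite in_fset.
- by move=> r /h3[p hp]; rewrite mem_subtable => /andP[_ h]; exists p.
- move=> p r hp hr hall.
  have hm : r \in domf (rows (subtable T p)) by rewrite mem_subtable hr.
  case: (h4 p hp) => [e|/(_ [` hm]) e]; first by move: hm; rewrite e in_fset0.
  by rewrite -(fnd_subtable hm) (in_fnd hm) e.
- by move=> f /h2; rewrite in_fset.
- move=> r hr; have [p hp hall] := h3 r hr; exists p => //.
  by rewrite mem_subtable hall andbT -fndSome hr.
- move=> p hp; right=> -[r hr]; have := hr.
  rewrite mem_subtable => /andP[rT ra].
  have := fnd_subtable hr.
  by rewrite (h4 _ _ hp rT ra) (in_fnd hr) => -[].
Qed.

(** * Trees made of single-path chains *)

Fixpoint chain (p : seq (nat * 'I_k)) : node k :=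
  if p is e :: p' then Inner e.1 (e.2, chain p') [::] else Terminal k true.

(** All the nondeterminism sits at the root; [p] is kept apart because the root needs a child. *)
Definition chain_tree p (ps : seq (seq (nat * 'I_k))) : dtree k :=
  Root (chain p) (map chain ps).

Lemma paths_chain p : node_paths (chain p) = [:: p].
Proof. by elim: p => //= -[f d] p ->. Qed.

Lemma terminals_chain p : node_terminals (chain p) = [:: true].
Proof. by elim: p => //= -[f d] p ->. Qed.

Lemma attrs_chain p : node_attrs (chain p) = path_word p.
Proof. by elim: p => //= -[f d] p ->; rewrite cats0. Qed.

Lemma complete_paths_chain_tree p ps :
  complete_paths (chain_tree p ps) = p :: ps.
Proof.
rewrite /complete_paths /= paths_chain; congr cons.
by elim: ps => //= q ps ->; rewrite paths_chain.
Qed.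

Lemma terminals_chain_tree p ps : all id (terminals (chain_tree p ps)).
Proof.
rewrite /terminals /= terminals_chain /=.
by elim: ps => //= q ps IH; rewrite terminals_chain.
Qed.

Lemma attrs_chain_tree p ps :
  tree_attrs (chain_tree p ps) = flatten (map (@path_word k) (p :: ps)).
Proof.
rewrite /tree_attrs /= attrs_chain -map_comp; congr (_ ++ flatten _).
by apply: eq_map => q; exact: attrs_chain.
Qed.

(** * Separating sets and upper bounds for psi^s *)

Lemma entry_None T r f : size r = size (cols T) -> f \notin cols T ->
  entry T r f = None.
Proof. by move=> sr fT; rewrite /entry onth_default // memNindex // sr. Qed.

Lemma separates_attrs T r : r \in domf (rows T) -> separates T r (attrs T).
Proof.
move=> hr; split=> // r' hr' ne; apply: contrapT => h; case/eqP: ne.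
apply: eq_from_onth_le => i; rewrite !(size_row hr, size_row hr') maxnn => ilt.
have /andP[uc _] := rectangular_table T.
apply/esym/eqP; apply: contrapT => /negP ne; apply: h.
exists (nth 0 (cols T) i); first by rewrite in_fset mem_nth.
by rewrite /entry index_uniq.
Qed.

(** On the rows of [T] this is [del_word] for P(T) \ D, indexed by the kept columns. *)
Definition restrict_row (D : {fset nat}) T r :=
  mask [seq f \in D | f <- cols T] r.

Section Measure.
Variable psi : seq nat -> nat.
Hypothesis psiP : bounded_measure psi.

(** The axioms give monotonicity for prefixes only; removing the letters of [u] from [w] one by one
    shows that [w] is a permutation of some [u ++ v]. *)
Lemma psi_sub u w : uniq u -> {subset u <= w} -> psi u <= psi w.
Proof.
have [[_ psi_perm psi_cat] _] := psiP.
move=> uu uw; suff [v /psi_perm->] : exists v, perm_eq w (u ++ v).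
  by have /andP[] := psi_cat u v.
elim: u w uu uw => [|x u IH] w /=; first by exists w.
move=> /andP[xu uu] uw.
have xw : x \in w by apply: uw; rewrite mem_head.
have [|v uv] := IH (rem x w) uu.
  move=> y yu; apply: rem_mem; last by apply: uw; rewrite inE yu orbT.
  by apply: contraNneq xu => <-.
by exists v; rewrite (perm_trans (perm_to_rem xw)) // perm_cons.
Qed.

(** Besides the bound, this shows that the minimum in [psi_s] is over a nonempty set, hence is not a
    default 0. *)
Lemma exists_strongly_nondet T b (d0 : 'I_k) :
  ~~ constant_table T ->
  (forall r, r \in domf (rows T) ->
     exists2 D, separates T r D & psi_set psi D <= b) ->
  exists2 G, strongly_nondet T G & psi_tree psi G <= b.
Proof.
move=> nc hb.
pose D r := xget fset0 [set D | separates T r D /\ psi_set psi D <= b]%classic.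
have DP r : r \in domf (rows T) ->
    separates T r (D r) /\ psi_set psi (D r) <= b.
  move=> /hb[E h1 h2].
  by apply: (@xgetPex _ _
    [set D | separates T r D /\ psi_set psi D <= b]%classic); exists E.
(* The default [d0] never shows for a row of [T], since [D r] consists of columns of [T]. *)
pose word r := [seq (f, odflt d0 (entry T r f)) | f <- enum_fset (D r)].
pose trues :=
  [seq r <- enum_fset (domf (rows T)) | (rows T).[? r] == Some true].
(* The chain of [r] accepts [r] and no other row. *)
have wordP r r' : r \in domf (rows T) -> r' \in domf (rows T) ->
    all (fun e => entry T r' e.1 == Some e.2) (word r) = (r' == r).
  move=> hr hr'; have [[/fsubsetP sub sep] _] := DP r hr.
  have rowE r1 f : r1 \in domf (rows T) -> f \in D r ->
      Some (odflt d0 (entry T r1 f)) = entry T r1 f.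
    move=> h1 /sub; rewrite in_fset => fT.
    have := onthTE r1 (index f (cols T)).
    by rewrite (size_row h1) index_mem fT /entry; case: onth.
  apply/idP/eqP => [/allP h|->].
    apply: contrapT => /eqP /(sep _ hr')[f fD]; apply/negP; rewrite negbK.
    by rewrite -(rowE r f) // eq_sym; apply: (h (f, _)); apply: map_f.
  by apply/allP => _ /mapP[f fD ->] /=; rewrite rowE.
have trueP r : reflect ((rows T).[? r] = Some true) (r \in trues).
  rewrite mem_filter; apply: (iffP andP) => [[/eqP]//|e].
  by rewrite e eqxx -fndSome e.
have trueD r : r \in trues -> r \in domf (rows T).
  by rewrite mem_filter => /andP[].
(* If all decisions were 0, the table would be constant. *)
have [r0 r0T] : exists r0, r0 \in trues.
  apply: contrapT => h; case/negP: nc.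
  apply/forallP => r; apply/forallP => r'.
  suff e (x : domf (rows T)) : rows T x = false by rewrite !e.
  case: x => x xT; apply/negbTE/negP => xt; apply: h.
  by exists x; apply/trueP; rewrite (in_fnd xT) xt.
pose G := chain_tree (word r0) (map word trues).
have GP p : p \in complete_paths G -> exists2 r, r \in trues & p = word r.
  rewrite complete_paths_chain_tree inE => /predU1P[->|]; first by exists r0.
  by move=> /mapP[r hr ->]; exists r.
have sG : strongly_nondet T G.
  apply/strongly_nondetP; split.
  - exact: terminals_chain_tree.
  - move=> f; rewrite attrs_chain_tree -complete_paths_chain_tree.
    move=> /flatten_mapP[p /GP[r /trueD hr ->]].
    rewrite /path_word -map_comp map_id_in //.
    by have [[/fsubsetP sub _] _] := DP r hr => /sub; rewrite in_fset.
  - move=> r /trueP hr; exists (word r).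
      by rewrite complete_paths_chain_tree inE map_f ?orbT.
    by rewrite wordP ?trueD.
  - move=> p r /GP[r1 hr1 ->] hr; rewrite wordP // ?trueD // => /eqP->.
    exact/trueP.
exists G => //; apply/bigmax_leqP_seq => p /GP[r /trueD hr ->] _.
by rewrite /path_word -map_comp map_id; have [] := DP r hr.
Qed.

Lemma psi_s_le T b (d0 : 'I_k) :
  (forall r, r \in domf (rows T) ->
     exists2 D, separates T r D & psi_set psi D <= b) ->
  psi_s psi T <= b.
Proof.
rewrite /psi_s; case: ifPn => // nc hb.
have [G sG Gb] := exists_strongly_nondet d0 nc hb.
have [|_ hmin] := @min_ofP
  [set psi_tree psi G | G in [set G | strongly_nondet T G]]%classic
  (psi_tree psi G).
  by exists G.
by apply: leq_trans (hmin (psi_tree psi G) _) Gb; exists G.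
Qed.

(** The set of all columns separates every row, so the minimum is attained. *)
Lemma S_rowP T r : r \in domf (rows T) ->
  is_min [set psi_set psi D | D in separates T r]%classic (S_row psi T r).
Proof.
move=> hr; apply: (@min_ofP _ (W_psi psi T)).
by exists (attrs T) => //; exact: separates_attrs.
Qed.

Lemma psi_s_le_S T (d0 : 'I_k) : psi_s psi T <= S_psi psi T.
Proof.
apply: psi_s_le => // r hr; have [[D sD eD] _] := S_rowP hr; exists D => //.
by rewrite eD /S_psi; apply: leq_bigmax_seq.
Qed.

Lemma psi_s_le_W T (d0 : 'I_k) : psi_s psi T <= W_psi psi T.
Proof.
apply: psi_s_le => // r hr; exists (attrs T) => //; exact: separates_attrs.
Qed.

(** * Minimal separating sets *)

(** Take a separating set of least measure and, among those, of least cardinality. Dropping [f] does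
    not raise the measure, so [D] without [f] cannot separate; the row it misses is [r']. *)
Lemma minimal_separating T r : r \in domf (rows T) ->
  exists D, [/\ separates T r D, psi_set psi D = S_row psi T r &
    forall f, f \in D -> exists r', [/\ r' \in domf (rows T), r' != r &
      forall g, g \in D -> g != f -> entry T r' g = entry T r g]].
Proof.
move=> hr; have [[D0 sD0 eD0] mS] := S_rowP hr.
pose P n := `[< exists D, [/\ separates T r D, psi_set psi D = S_row psi T r
  & #|` D| = n] >].
have exP : exists n, P n by exists #|` D0|; apply/asboolP; exists D0.
case: (ex_minnP exP) => n /asboolP[D [sD eD cD]] nmin.
exists D; split=> // f fD; apply: contrapT => hno.
have sub := fsubD1set D f.
suff sDf : separates T r (D `\ f).
  have eDf : psi_set psi (D `\ f) = S_row psi T r.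
    apply/eqP; rewrite eqn_leq mS; last by exists (D `\ f).
    by rewrite -eD andbT; apply: psi_sub; [exact: fset_uniq|exact/fsubsetP].
  have : n <= #|` D `\ f| by apply: nmin; apply/asboolP; exists (D `\ f).
  by rewrite -cD (cardfsD1 f D) fD add1n ltnn.
have [DT _] := sD; split; first exact: fsubset_trans sub DT.
move=> r' hr' ne; apply: contrapT => same; apply: hno; exists r'; split=> //.
move=> g gD gf; apply/esym/eqP; apply: contrapT => /negP gne; apply: same.
by exists g => //; rewrite in_fsetD1 gf.
Qed.

(** * Projection of a table to a set of columns *)

Section Project.
Variables (T : table k) (D : {fset nat}) (nu : seq 'I_k -> bool).
Hypotheses (DT : D `<=` attrs T) (D0 : D != fset0).
Hypothesis T0 : domf (rows T) != fset0.

(** Since [opI] takes the deleted columns, keeping [D] means deleting its complement. As [D] and the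
    set of rows are nonempty, nothing collapses to Λ. *)
Let E := attrs T `\` D.
Let T' := opJ nu (opI E T).

Let del_colsE : del_cols E T = [seq f <- cols T | f \in D].
Proof.
by apply: eq_in_filter => f fT; rewrite in_fsetD in_fset /= fT andbT negbK.
Qed.

Let del_cols0 : del_cols E T != [::].
Proof.
have /fset0Pn[f fD] := D0; apply/eqP => e.
have : f \in del_cols E T.
  rewrite del_colsE mem_filter fD.
  by have := fsubsetP DT _ fD; rewrite in_fset.
by rewrite e.
Qed.

Let del_wordE r : del_word E T r = restrict_row D T r.
Proof.
congr mask; apply/eq_in_map => f fT.
by rewrite in_fsetD in_fset /= fT andbT negbK.
Qed.

Let del_rows0 : domf (del_rows E T) != fset0.
Proof.
have /fset0Pn[r hr] := T0; apply/fset0Pn; exists (del_word E T r).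
by apply/imfsetP; exists r.
Qed.

Let cols_opI : cols (opI E T) = del_cols E T.
Proof.
by rewrite cols_make_table /degenerate (negPf del_cols0) (negPf del_rows0).
Qed.

Let rows_opI : rows (opI E T) = del_rows E T.
Proof. exact: rows_make_table. Qed.

Lemma cols_project : cols T' = [seq f <- cols T | f \in D].
Proof.
rewrite cols_make_table /degenerate cols_opI (negPf del_cols0) /= rows_opI.
by rewrite (negPf del_rows0).
Qed.

Lemma rows_project : rows T' = relabel nu (opI E T).
Proof. by rewrite rows_make_table // cols_opI. Qed.

Lemma attrs_project : attrs T' = D.
Proof.
apply/fsetP => f; rewrite in_fset cols_project mem_filter andb_idr //.
by move=> /(fsubsetP DT); rewrite in_fset.
Qed.

Lemma mem_projectP s :
  reflect (exists2 r, r \in domf (rows T) & s = restrict_row D T r)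
    (s \in domf (rows T')).
Proof.
rewrite rows_project /= rows_opI.
apply: (equivP (imfsetP _ _ _ _)).
by split=> -[r hr ->]; exists r => //; rewrite del_wordE.
Qed.

Lemma fnd_project s : s \in domf (rows T') -> (rows T').[? s] = Some (nu s).
Proof. by rewrite rows_project => h; rewrite (in_fnd h) ffunE. Qed.

Lemma entry_project r f : r \in domf (rows T) -> f \in D ->
  entry T' (restrict_row D T r) f = entry T r f.
Proof.
by move=> hr fD; rewrite /entry cols_project onth_index_mask // (size_row hr).
Qed.

End Project.

(** * Tables whose psi^s equals a given row measure *)

Lemma closed_class_attains (A : set (table k)) T r (d0 : 'I_k) :
  closed_class A -> A T -> r \in domf (rows T) -> 0 < S_row psi T r ->
  exists2 T', A T' &
    W_psi psi T' = S_row psi T r /\ psi_s psi T' = S_row psi T r.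
Proof.
move=> [_ closedA] AT hr S0.
have [D [[DT sepD] eD crit]] := minimal_separating hr.
have [[psi0 _ _] _] := psiP.
have T0 : domf (rows T) != fset0 by apply/fset0Pn; exists r.
have D0 : D != fset0.
  apply: contraTneq S0 => D0; rewrite -eD D0 -leqNgt leqn0; apply/eqP.
  exact/psi0.
pose proj := restrict_row D T.
pose nu s := s == proj r.
pose T' := opJ nu (opI (attrs T `\` D) T).
have mem' r' : r' \in domf (rows T) -> proj r' \in domf (rows T').
  by move=> h; apply/mem_projectP => //; exists r'.
have fnd' r' : r' \in domf (rows T) ->
    (rows T').[? proj r'] = Some (proj r' == proj r).
  by move=> h; rewrite fnd_project ?mem'.
(* A column of [D] separating [r'] from [r] survives the projection, so no other row merges with
   [r]. *)
have proj_neq r' : r' \in domf (rows T) -> r' != r -> proj r' != proj r.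
  move=> hr' /(sepD _ hr')[f fD]; apply: contraNneq => e.
  by rewrite -!(entry_project nu DT D0 T0 _ fD) // -/proj e.
have WT' : W_psi psi T' = S_row psi T r by rewrite /W_psi attrs_project.
exists T'.
  rewrite -closedA; exists T => //; exists (attrs T `\` D), nu.
  by split=> //; exact: fsubsetDl.
(* One inequality is the bound by [W_psi]; the lower bound remains. *)
split=> //; apply/eqP; rewrite eqn_leq -{1}WT' psi_s_le_W //=.
have nc : ~~ constant_table T'.
  apply/negP => /forallP cst.
  have /fset0Pn[f fD] := D0; have [r' [hr' ne _]] := crit f fD.
  have := cst [` mem' r hr] => /forallP /(_ [` mem' r' hr']) /eqP e.
  have := fnd' r' hr'; rewrite (in_fnd (mem' r' hr')) -e -(in_fnd (mem' r hr)).
  by rewrite fnd' // eqxx (negPf (proj_neq _ hr' ne)).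
rewrite /psi_s (negPf nc).
have [G0 sG0 _] := exists_strongly_nondet d0 nc
  (fun r hr => ex_intro2 _ _ (attrs T') (separates_attrs hr) (leqnn _)).
have [|[G sG <-] _] := @min_ofP
  [set psi_tree psi G | G in [set G | strongly_nondet T' G]]%classic
  (psi_tree psi G0).
  by exists G0.
have /strongly_nondetP[_ _ h3 h4] := sG.
have [|p pG /allP pr] := h3 (proj r); first by rewrite fnd' // eqxx.
apply: leq_trans (leq_bigmax_seq p pG isT).
rewrite -eD; apply: psi_sub; first exact: fset_uniq.
(* If the accepting path [p] of [proj r] skips [f], the critical row for [f] agrees with [r] on all
   of [p], so its image must have decision 1, whereas [nu] gives it 0. *)
move=> f fD; apply: contrapT => fp.
have [r' [hr' ne same]] := crit f fD.
suff : (rows T').[? proj r'] = Some true.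
  by rewrite fnd' // (negPf (proj_neq _ hr' ne)).
apply: h4 (pG) (mem' _ hr') _; apply/allP => e ep.
have pe := pr e ep.
(* The entry of [proj r] at [e.1] is defined, so [e.1] labels a column of [T']. *)
have eT : e.1 \in D.
  apply: contraTT pe => nD; rewrite entry_None //.
    by rewrite (size_row (mem' r hr)).
  by move: nD; rewrite -(attrs_project nu DT D0 T0) in_fset.
have ef : e.1 != f by apply: contra_notN fp => /eqP <-; apply: map_f.
by rewrite /proj entry_project // same // -(entry_project nu DT D0 T0 hr eT).
Qed.

End Measure.
End Tables.

(** * Increasing enumerations and step functions *)

Lemma unbounded_enum (P : nat -> Prop) :
  (forall b, exists2 n, b < n & P n) ->
  exists d : nat -> nat, (forall i, d i < d i.+1) /\ forall i, P (d i).
Proof.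
move=> unb.
have /choice[next nextP] : forall b, exists n, b < n /\ P n.
  by move=> b; have [n] := unb b; exists n.
(* The shift by one makes [d 0] a value of [next], so that it satisfies [P] too. *)
exists (fun i => iter i.+1 next 0); split=> i /=.
  by have [] := nextP (next (iter i next 0)).
by have [] := nextP (iter i next 0).
Qed.

Lemma H_fun_le (d : nat -> nat) (G : nat -> nat) n :
  (forall i, d i < d i.+1) -> {homo G : m n / m <= n} ->
  (forall i, d i <= G (d i)) -> H_fun d n <= G n.
Proof.
move=> dS Gmono dG; rewrite /H_fun; case: ltnP => // d0n.
(* The largest [i] with [d i <= n] exists because [i <= d i]; so [xget] does not return its
   default. *)
have /(@xgetPex _ 0 [set i | d i <= n < d i.+1]%classic) /= :
    exists i, d i <= n < d i.+1.
  have d_ge i : i <= d i by elim: i => // i /leq_ltn_trans; apply.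
  have ub i : d i <= n -> i <= n by exact: leq_trans.
  have ex : exists i, d i <= n by exists 0.
  case: (ex_maxnP ex ub) => i din imax; exists i; rewrite din /= ltnNge.
  by apply/negP => /imax; rewrite ltnn.
by move=> /andP[din _]; apply: leq_trans (dG _) (Gmono _ _ din).
Qed.

(** As [d] is injective, a finite range would have a finite preimage, which is all of the
    naturals. *)
Lemma infinite_range_increasing (d : nat -> nat) :
  (forall i, d i < d i.+1) -> infinite_set (range d).
Proof.
move=> dS fin; apply: infinite_nat; rewrite -(preimage_range d).
apply: finite_preimage fin => i j _ _; apply: incn_inj; apply: leq_mono.
exact: homo_ltn ltn_trans dS.
Qed.

(** * Growth of G *)

Theorem theorem7 (k : nat) (hk : 2 <= k) (psi : seq nat -> nat)
    (hpsi : bounded_measure psi) (A : set (table k)) (hA : closed_class A) :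
  [/\ forall n, is_max (G_values psi A n) (G_fun psi A n),
      forall m n, m <= n -> G_fun psi A m <= G_fun psi A n,
      (exists b, forall T, A T -> S_psi psi T <= b) ->
        exists c, forall n, G_fun psi A n <= c &
      ~ (exists b, forall T, A T -> S_psi psi T <= b) ->
        exists (D : set nat) (d : nat -> nat),
          [/\ infinite_set D, increasing_enum D d &
              forall n, H_fun d n <= G_fun psi A n <= n]].
Proof.
pose d0 : 'I_k := Ordinal hk.
have [[T1 AT1] closedA] := hA.
(* Deleting all columns gives Λ, which makes [G_values] nonempty for every [n], even 0. *)
have [T0 AT0 WT0] : exists2 T0, A T0 & W_psi psi T0 = 0.
  pose nu := fun _ : seq 'I_k => true.
  exists (opJ nu (opI (attrs T1) T1)).
    by rewrite -closedA; exists T1 => //; exists (attrs T1), nu.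
  have c0 : cols (opI (attrs T1) T1) = [::].
    rewrite cols_make_table /degenerate; case: ifP => // _.
    rewrite /del_cols -[RHS](filter_pred0 (cols T1)).
    apply: eq_in_filter => f fT.
    by rewrite in_fset /= fT.
  have [[psi0 _ _] _] := hpsi; apply/psi0.
  suff -> : attrs (opJ nu (opI (attrs T1) T1)) = fset0 by [].
  by apply/fsetP => f; rewrite in_fset cols_make_table c0.
have Gmax n : is_max (G_values psi A n) (G_fun psi A n).
  apply: (@max_ofP _ (psi_s psi T0) n); first by exists T0 => //=; rewrite WT0.
  by move=> _ [T [AT WT] <-]; apply: leq_trans (psi_s_le_W _ _ d0) WT.
have Gn n : G_fun psi A n <= n.
  have [[T [AT WT] <-] _] := Gmax n.
  exact: leq_trans (psi_s_le_W _ _ d0) WT.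
have Gmono : {homo G_fun psi A : m n / m <= n}.
  move=> m n mn; have [[T [AT WT] <-] _] := Gmax m.
  have [_] := Gmax n; apply; exists T => //; split=> //.
  exact: leq_trans mn.
split=> //.
  move=> [b Sb]; exists b => n; have [[T [AT _] <-] _] := Gmax n.
  exact: leq_trans (psi_s_le_S _ _ d0) (Sb T AT).
move=> unb.
(* With [Gn], these are the [n] where G(n) = n. If none exceeded [b], then [b] would bound [S_psi]
   on [A], since any larger row measure is such an [n]. *)
have [|d [dS dG]] := @unbounded_enum (fun n => n <= G_fun psi A n).
  move=> b; apply: contrapT => no; apply: unb; exists b => T AT.
  apply/bigmax_leqP_seq => r hr _; rewrite leqNgt; apply/negP => bS.
  have [|T' AT' [WT' psT']] := closed_class_attains hpsi d0 hA AT hr.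
    exact: leq_ltn_trans bS.
  apply: no; exists (S_row psi T r) => //.
  have [_] := Gmax (S_row psi T r); apply; exists T' => //; split=> //.
  by rewrite WT'.
exists (range d), d; split=> //; first exact: infinite_range_increasing.
by move=> n; rewrite Gn andbT; exact: H_fun_le.
Qed.
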